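(* Let $n\geq 2$ and $q\geq 3$ be integers and let $W$ be a $q^n\times q^n$ type II matrix. Let $A(n)$ be the adjacency matrix of the Hamming graph $H(n,q)$, $$A(n)=\sum_{k=1}^{n} I_q^{\otimes (k-1)}\otimes (J_q-I_q)\otimes I_q^{\otimes (n-k)}.$$ If $A(n)\in \mathcal{N}_W$, then there exist $q\times q$ type II matrices $W_1,\ldots,W_n$ such that $W$ is type II equivalent to $W_1\otimes W_2\otimes\cdots\otimes W_n$ and $$\mathcal{N}_W=\mathcal{N}_{W_1}\otimes\cdots\otimes\mathcal{N}_{W_n}.$$
   Context: All matrices are over $\mathbb{C}$. $I_v$ and $J_v$ are the $v\times v$ identity and all-ones matrices, $\otimes$ is the Kronecker product, and for algebras (subspaces) of matrices $\mathcal{B}_1,\ldots,\mathcal{B}_n$, $\mathcal{B}_1\otimes\cdots\otimes\mathcal{B}_n$ is the span of all $B_1\otimes\cdots\otimes B_n$ with $B_i\in\mathcal{B}_i$. A $v\times v$ matrix $W$ with no zero entries is a type II matrix if $\sum_{x=1}^v \frac{W(x,a)}{W(x,b)}=\delta_{a,b}v$ for all $a,b=1,\ldots,v$. Two type II matrices $W,W'$ are type II equivalent if $W=P_1D_1W'D_2P_2$ for some invertible diagonal matrices $D_1,D_2$ and permutation matrices $P_1,P_2$. For a $v\times v$ type II matrix $W$ and $a,b\in\{1,\ldots,v\}$, let $Y_{a,b}\in\mathbb{C}^v$ be the vector with entries $Y_{a,b}(x)=W(x,a)/W(x,b)$. The Nomura algebra $\mathcal{N}_W$ is the set of all $v\times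 v$ complex matrices $M$ such that every $Y_{a,b}$ ($a,b=1,\ldots,v$) is an eigenvector of $M$. *)

(* Defs.v *)
From mathcomp Require Import all_boot all_order all_algebra.
From mathcomp Require Import classical_sets reals complex mxtens.

Set Implicit Arguments.
Unset Strict Implicit.
Unset Printing Implicit Defensive.

Import GRing.Theory.

Local Open Scope ring_scope.
Local Open Scope classical_set_scope.

Section Defs.
Variable F : fieldType.

Definition type2 v (W : 'M[F]_v) : Prop :=
  (forall x a, W x a != 0) /\
  (forall a b, \sum_(x < v) W x a / W x b = if a == b then v%:R else 0).

Definition type2_equiv v (W W' : 'M[F]_v) : Prop :=
  exists P1 D1 D2 P2 : 'M[F]_v,
    [/\ is_perm_mx P1 /\ is_perm_mx P2,
        is_diag_mx D1 /\ D1 \in unitmx,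
        is_diag_mx D2 /\ D2 \in unitmx &
        W = P1 *m D1 *m W' *m D2 *m P2].

(* Eigenvectors are column vectors here, unlike in the library's (row-based)
   eigenspace. *)
Definition eigenvector v (M : 'M[F]_v) (y : 'cV[F]_v) : Prop :=
  y != 0 /\ exists lambda : F, M *m y = lambda *: y.

Definition quot_col v (W : 'M[F]_v) (a b : 'I_v) : 'cV[F]_v :=
  \col_x (W x a / W x b).

Definition nomura v (W : 'M[F]_v) : set 'M[F]_v :=
  [set M | forall a b, eigenvector M (quot_col W a b)].

(* B_0 *t (B_1 *t (... *t B_(n-1))), the empty product being the 1 x 1
   identity. *)
Fixpoint bigtens q n : ('I_n -> 'M[F]_q) -> 'M[F]_(q ^ n) :=
  match n with
  | 0 => fun=> 1%:M
  | n'.+1 => fun B =>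
      castmx (esym (expnS q n'), esym (expnS q n'))
        (B ord0 *t bigtens (fun i => B (lift ord0 i)))
  end.

Definition mx_span m (S : set 'M[F]_m) : set 'M[F]_m :=
  [set M | exists (k : nat) (c : 'I_k -> F) (X : 'I_k -> 'M[F]_m),
     (forall i, S (X i)) /\ M = \sum_(i < k) c i *: X i].

Definition tens_span q n (B : 'I_n -> set 'M[F]_q) : set 'M[F]_(q ^ n) :=
  mx_span [set bigtens T | T in [set T | forall i, B i (T i)]].

Definition hamming_adj q n : 'M[F]_(q ^ n) :=
  \sum_(k < n) bigtens (fun i => if i == k then const_mx 1 - 1%:M else 1%:M).

End Defs.

Arguments hamming_adj : clear implicits.

(* Main.v *)
Require Import Defs.
From HB Require Import structures.
From mathcomp Require Import all_boot all_order fingroup perm all_algebra.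
From mathcomp Require Import classical_sets reals complex mxtens.
From mathcomp Require Import ring.

(** Rows and columns of W are labelled by words x : {ffun I -> T}, with
    n = #|I| and q = #|T|, and quot w a b is the vector Y_(a,b) of quotients of
    columns a and b.  The matrix A(n) + n I sends a function f of words to the
    sum over i of its line sums (J_i f)(x) = sum_t f(x with x_i := t), so the
    hypothesis says that every Y_(a,b) is an eigenvector of the sum of the J_i,
    and the goal is to make it an eigenvector of each J_i separately.

    The eigenvalue q (n - 1) belongs to the functions of weight one, those of
    the form x |-> sum_i al_i (x_i) with all al_i of sum zero
    (weight1_coord_sum).  If Y_(b,a) has weight one, so does its inverse
    Y_(a,b), because A(n) is symmetric and Y_(a,b), Y_(b,a) are not orthogonal
    for the bilinear form sum_x f(x) g(x).  A nowhere zero sum of functions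
    al_i (x_i) whose inverse also has this form and which really depends on two
    coordinates i, j is very special: it is al_i (x_i) + al_j (x_j) with al_i
    and al_j of constant square (inverse_coord_sum).  Let Y_(b,a) be such a sum.
    Its product with any weight one Y_(c,b) is again an eigenvector, namely
    Y_(c,a), and this forces the i-th part of Y_(c,b) to be proportional to al_i
    (coord_sum_mul_eigen).  But the weight one Y_(c,b), b fixed, span all
    functions of weight one, whose i-th parts fill a space of dimension
    q - 1 > 1: this is where q >= 3 enters.  Hence every weight one quotient is
    a function of a single coordinate (weight1_only_on).

    For fixed b and i, the columns a for which Y_(a,b) is a function phi_a of
    x_i alone are then exactly q, and the phi_a are the columns of a q x q type
    II matrix W_i.  Comparing the eigenvector equations of Y_(c,b) and of
    Y_(c,a) = Y_(c,b) / phi_a, and summing over a, shows that Y_(c,b) is an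
    eigenvector of J_i (quot_line_sum_eigen).  So each Y_(c,a) is constant in
    x_i or has zero sum along the lines in direction i, and for one a in the
    class it is constant: dividing Y_(c,b) by the product of these phi_a over
    all i leaves a constant, which is the tensor factorisation of W
    (tensor_structure).

    For the Nomura algebras, one inclusion is the eigenvector property of
    tensors.  For the other, every slice of a matrix of the Nomura algebra of a
    tensor product, obtained by freezing all coordinates but the i-th, lies in
    the i-th Nomura algebra (nomuraf_slice); a matrix all of whose slices are
    fixed by linear projections onto the factors is the combination of tensor
    products of projected matrix units given by its own entries
    (tensor_expand). *)

Set Implicit Arguments.
Unset Strict Implicit.
Unset Printing Implicit Defensive.

Import Order.TTheory GRing.Theory Num.Theory.

Local Open Scope ring_scope.

(** * Words, line sums and the weight one eigenspace *)

Section Coordinates.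
Variables (F : numFieldType) (I T : finType).
Local Notation X := {ffun I -> T}.
Local Notation n := (#|I|%:R : F).
Local Notation q := (#|T|%:R : F).
Implicit Types (f g h : X -> F) (x y z : X) (i j k : I) (t : T).

Definition upd x i t : X := [ffun j => if j == i then t else x j].

Lemma upd_at x i t : upd x i t i = t.
Proof. by rewrite ffunE eqxx. Qed.

Lemma upd_ne x i t j : j != i -> upd x i t j = x j.
Proof. by rewrite ffunE => /negPf->. Qed.

Lemma upd_upd x i s t : upd (upd x i s) i t = upd x i t.
Proof. by apply/ffunP=> j; rewrite !ffunE; case: eqP. Qed.

Lemma upd_same x i : upd x i (x i) = x.
Proof. by apply/ffunP=> j; rewrite !ffunE; case: eqP => // ->. Qed.

Lemma updC x i j s t : i != j ->
  upd (upd x i s) j t = upd (upd x j t) i s.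
Proof.
move=> ij; apply/ffunP=> k; rewrite !ffunE.
by case: eqP => // ->; rewrite eq_sym (negPf ij).
Qed.

Lemma ffun_neqP x y : x != y -> exists i, x i != y i.
Proof.
move=> xy; apply/existsP; apply: contraNT xy; rewrite negb_exists.
by move=> /forallP e; apply/eqP/ffunP=> i; apply/eqP; rewrite -[_ == _]negbK e.
Qed.

Lemma invariant_upd (V : Type) (K : pred I) (f : X -> V) :
    (forall x j t, K j -> f (upd x j t) = f x) ->
  forall x y, (forall j, ~~ K j -> x j = y j) -> f x = f y.
Proof.
move=> fK x y; move: {2}#|_|.+1 (ltnSn #|[pred j | x j != y j]|) => m.
elim: m x => // m IHm x lexy exy.
have [j xyj | /= eqxy] := pickP [pred j | x j != y j]; last first.
  by congr f; apply/ffunP=> j; apply/eqP; move: (eqxy j) => /negbFE.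
have Kj : K j by apply: contraNT xyj => /exy->.
rewrite -(fK x j (y j) Kj); apply: IHm => [|k nKk]; last first.
  have [->|kj] := eqVneq k j; first exact: upd_at.
  by rewrite upd_ne // exy.
rewrite -ltnS; apply: leq_trans lexy; rewrite ltnS.
apply: proper_card; apply/properP; split.
  apply/fintype.subsetP=> k; rewrite !inE; have [->|kj] := eqVneq k j.
    by rewrite upd_at eqxx.
  by rewrite upd_ne.
by exists j; rewrite // inE upd_at eqxx.
Qed.

(** The swap of (x, t) with (x with x_i := t, x_i) is an involution on pairs;
    this replaces a splitting of the sum over x into lines. *)
Lemma sum_upd i f : \sum_x \sum_t f (upd x i t) = q * \sum_x f x.
Proof.
rewrite pair_big /=.
pose r (p : X * T) := (upd p.1 i p.2, p.1 i).
have rK : involutive r by move=> [x t]; rewrite /r /= upd_upd upd_same upd_at.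
rewrite (reindex_inj (inv_inj rK)) /=.
rewrite -(pair_bigA _ (fun x t => f (upd (upd x i t) i (x i)))) /= mulr_sumr.
apply: eq_bigr => x _.
under eq_bigr do rewrite upd_upd upd_same.
by rewrite sumr_const mulr_natl.
Qed.

Definition line_sum i f x := \sum_t f (upd x i t).

Lemma eq_line_sum i f g : f =1 g -> line_sum i f =1 line_sum i g.
Proof. by move=> efg x; apply: eq_bigr => t _. Qed.

Lemma line_sum_eq0 i f : (forall x, f x = 0) -> forall x, line_sum i f x = 0.
Proof. by move=> f0 x; rewrite /line_sum big1. Qed.

Lemma line_sum_upd i f x t : line_sum i f (upd x i t) = line_sum i f x.
Proof. by apply: eq_bigr => s _; rewrite upd_upd. Qed.

Lemma line_sumC i j f x :
  line_sum i (line_sum j f) x = line_sum j (line_sum i f) x.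
Proof.
have [->//|ij] := eqVneq i j.
rewrite /line_sum exchange_big; apply: eq_bigr => t _; apply: eq_bigr => s _.
by rewrite updC.
Qed.

Lemma line_sum_inv i f x :
  (forall t, f (upd x i t) = f x) -> line_sum i f x = q * f x.
Proof.
move=> fi; rewrite /line_sum (eq_bigr _ (fun t _ => fi t)).
by rewrite sumr_const mulr_natl.
Qed.

Lemma line_sum_idem i f x : line_sum i (line_sum i f) x = q * line_sum i f x.
Proof. by rewrite line_sum_inv // => t; rewrite line_sum_upd. Qed.

Lemma sum_line_sum i f : \sum_x line_sum i f x = q * \sum_x f x.
Proof. exact: sum_upd. Qed.

Hypothesis T_gt0 : (0 < #|T|)%N.

Lemma ffun_point : exists x0 : X, x0 \in X.
Proof. by apply/card_gt0P; rewrite card_ffun expn_gt0 T_gt0. Qed.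

Lemma cardT_neq0 : q != 0.
Proof. by rewrite pnatr_eq0 -lt0n. Qed.

Lemma sum_eq0_line_sum i f : (forall x, line_sum i f x = 0) -> \sum_x f x = 0.
Proof.
move=> f0; apply: (mulfI cardT_neq0); rewrite -(sum_line_sum i) mulr0.
by rewrite big1.
Qed.

Lemma line_sum_sym i f g :
  \sum_x line_sum i f x * g x = \sum_x f x * line_sum i g x.
Proof.
apply: (mulfI cardT_neq0); rewrite -!(sum_line_sum i); apply: eq_bigr => x _.
transitivity (line_sum i f x * line_sum i g x).
  rewrite [line_sum i g x]/line_sum mulr_sumr; apply: eq_bigr => t _.
  by rewrite line_sum_upd.
rewrite [line_sum i f x]/line_sum mulr_suml; apply: eq_bigr => t _.
by rewrite line_sum_upd.
Qed.

(** The sum of the line sums is the action of A(n) + n I, so mu is an eigenvalue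
    of A(n) shifted by n. *)
Definition hamming_eigen (mu : F) f :=
  forall x, \sum_i line_sum i f x = mu * f x.

Lemma hamming_eigen_ortho mu nu f g :
  hamming_eigen mu f -> hamming_eigen nu g -> mu != nu ->
  \sum_x f x * g x = 0.
Proof.
move=> ef eg munu; have mnz : mu - nu != 0 by rewrite subr_eq0.
apply: (mulfI mnz); rewrite mulr0 mulrBl !mulr_sumr.
apply/eqP; rewrite subr_eq0; apply/eqP.
transitivity (\sum_x \sum_i line_sum i f x * g x).
  by apply: eq_bigr => x _; rewrite -mulr_suml ef mulrA.
rewrite exchange_big; under eq_bigr do rewrite line_sum_sym.
rewrite exchange_big; apply: eq_bigr => x _.
by rewrite -mulr_sumr eg mulrCA.
Qed.

(** q times the projection that kills the functions constant in x_i. *)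
Definition line_defect i f x := q * f x - line_sum i f x.

Lemma line_sum_defect i j f x :
  line_sum i (line_defect j f) x = line_defect j (line_sum i f) x.
Proof.
rewrite /line_sum /line_defect sumrB -mulr_sumr; congr (_ - _).
exact: line_sumC.
Qed.

Lemma line_sum_defect0 i f x : line_sum i (line_defect i f) x = 0.
Proof. by rewrite line_sum_defect /line_defect line_sum_idem subrr. Qed.

Lemma hamming_eigen_defect mu i f :
  hamming_eigen mu f -> hamming_eigen mu (line_defect i f).
Proof.
move=> ef x; under eq_bigr do rewrite line_sum_defect.
rewrite /line_defect sumrB -mulr_sumr ef mulrBr mulrCA; congr (_ - _).
rewrite /line_sum exchange_big mulr_sumr; apply: eq_bigr => t _; exact: ef.
Qed.

Lemma line_sum_norm i f : \sum_x `|line_sum i f x| <= q * \sum_x `|f x|.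
Proof.
rewrite -(sum_upd i); apply: ler_sum => x _; exact: ler_norm_sum.
Qed.

(** On functions of weight j the eigenvalue is q (n - j). *)
Definition weight1_value := q * (n - 1).

Lemma card_outside2 i j :
  i != j -> #|[pred k | (k != i) && (k != j)]|%:R = n - 2.
Proof.
move=> ij; have -> : #|I| = #|[pred k | (k != i) && (k != j)]|.+2.
  by rewrite -!sum1_card (bigD1 i) // (bigD1 j) 1?eq_sym.
by rewrite -addn2 natrD addrK.
Qed.

(** The double defect g is an eigenvector for q (n - 1) on which J_i and J_j
    vanish.  The remaining n - 2 operators J_k have l1-norm at most q, so their
    sum cannot reach the eigenvalue q (n - 1) unless g = 0. *)
Lemma weight1_defect2 i j f : i != j -> hamming_eigen weight1_value f ->
  forall x, line_defect i (line_defect j f) x = 0.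
Proof.
move=> ij ef; set g := line_defect i _.
have eg : hamming_eigen weight1_value g by do 2!apply: hamming_eigen_defect.
have gi x : line_sum i g x = 0 by apply: line_sum_defect0.
have gj x : line_sum j g x = 0.
  rewrite /g line_sum_defect.
  transitivity (q * line_sum j (line_defect j f) x -
    line_sum i (line_sum j (line_defect j f)) x) => //.
  rewrite (line_sum_eq0 i (line_sum_defect0 j f)) line_sum_defect0.
  by rewrite mulr0 subrr.
pose S := \sum_x `|g x|.
have S_ge0 : 0 <= S by apply: sumr_ge0.
have leS : weight1_value * S <= q * (n - 2) * S.
  have w_ge0 : 0 <= weight1_value.
    by rewrite mulr_ge0 ?ler0n // subr_ge0 ler1n; apply/card_gt0P; exists i.
  have -> : weight1_value * S = \sum_x `|\sum_k line_sum k g x|.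
    by rewrite mulr_sumr; apply: eq_bigr => x _; rewrite eg normrM ger0_norm.
  apply: (@le_trans _ _
      (\sum_x \sum_(k | (k != i) && (k != j)) `|line_sum k g x|)).
    apply: ler_sum => x _; rewrite (bigD1 i) // (bigD1 j) 1?eq_sym //= gi gj.
    by rewrite !add0r ler_norm_sum.
  rewrite exchange_big /=.
  apply: (@le_trans _ _ (\sum_(k | (k != i) && (k != j)) q * S)).
    by apply: ler_sum => k _; apply: line_sum_norm.
  rewrite -(card_outside2 ij).
  by rewrite sumr_const -[leLHS]mulr_natl -[leRHS]mulrA [leLHS]mulrCA.
have S0 : S = 0.
  apply: le_anti; rewrite S_ge0 andbT.
  have : q * S <= 0.
    move: leS; rewrite -subr_le0 /weight1_value.
    by have -> : q * (n - 1) * S - q * (n - 2) * S = q * S by ring.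
  have q_gt0 : 0 < q by rewrite ltr0n.
  by rewrite pmulr_rle0.
move=> x; apply/eqP; rewrite -normr_eq0.
by apply/eqP; apply: (psumr_eq0P _ S0).
Qed.

Definition coord_sum (al : I -> T -> F) f :=
  (forall i, \sum_t al i t = 0) /\ forall x, f x = \sum_i al i (x i).

Lemma line_defect0_inv i f : (forall x, line_defect i f x = 0) ->
  forall x t, f (upd x i t) = f x.
Proof.
move=> f0 x t; apply: (mulfI cardT_neq0); move/eqP: (f0 x); rewrite subr_eq0.
move/eqP->; move/eqP: (f0 (upd x i t)); rewrite subr_eq0 => /eqP->.
exact: line_sum_upd.
Qed.

(** By weight1_defect2, the defect of f in direction i is constant in every
    other coordinate, and by the eigenvalue equation these defects add up to
    q f: they are the summands. *)
Lemma weight1_coord_sum f :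
  hamming_eigen weight1_value f -> exists al, coord_sum al f.
Proof.
move=> ef.
have [t0 _] : exists t, t \in T by apply/card_gt0P.
have Df i x y : x i = y i -> line_defect i f x = line_defect i f y.
  move=> xyi; apply: (@invariant_upd _ (fun j => j != i)) => [z j t ji|j].
    apply: line_defect0_inv => {}z; exact: weight1_defect2.
  by rewrite negbK => /eqP->.
exists (fun i t => q^-1 * line_defect i f [ffun=> t]); split=> [i|x].
  rewrite -mulr_sumr; apply/eqP; rewrite mulf_eq0; apply/orP; right; apply/eqP.
  rewrite -[RHS](line_sum_defect0 i f [ffun=> t0]) [RHS]/line_sum.
  apply: eq_bigr => t _.
  by apply: Df; rewrite upd_at ffunE.
rewrite -mulr_sumr; apply: (mulfI cardT_neq0); rewrite mulVKf ?cardT_neq0 //.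
rewrite (eq_bigr (fun i => line_defect i f x)); last first.
  by move=> i _; apply: Df; rewrite ffunE.
by rewrite sumrB ef sumr_const /weight1_value -[#|_|]/(#|I|) -mulr_natl; ring.
Qed.

Lemma sum_coord_sum al f : coord_sum al f -> \sum_x f x = 0.
Proof.
move=> [al0 fE]; under eq_bigr do rewrite fE.
rewrite exchange_big big1 // => i _; apply: (@sum_eq0_line_sum i) => x.
by rewrite /line_sum -[RHS](al0 i); apply: eq_bigr => t _; rewrite upd_at.
Qed.

End Coordinates.

(** * Type II matrices indexed by a finite type *)

Section TypeII.
Variables (F : numFieldType) (X : finType) (w : X -> X -> F).

Definition typeII :=
  (forall x a, w x a != 0) /\
  (forall a b, \sum_x w x a / w x b = if a == b then #|X|%:R else 0).

Definition quot a b x := w x a / w x b.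

Hypothesis wII : typeII.

Lemma w_neq0 x a : w x a != 0. Proof. exact: wII.1. Qed.

Lemma quot_neq0 a b x : quot a b x != 0.
Proof. by rewrite mulf_neq0 ?invr_eq0 ?w_neq0. Qed.

Lemma quotM a b c x : quot a b x * quot b c x = quot a c x.
Proof. by rewrite /quot mulrA divfK ?w_neq0. Qed.

Lemma quotV a b x : (quot a b x)^-1 = quot b a x.
Proof. by rewrite /quot invf_div. Qed.

Lemma quot_id a x : quot a a x = 1.
Proof. by rewrite /quot divff ?w_neq0. Qed.

(** The defining sums say that the transposed inverse entries form, up to the
    factor #|X|, a left inverse of w; a left inverse is a right inverse. *)
Lemma typeII_dual x y :
  \sum_c w x c / w y c = if x == y then #|X|%:R else 0.
Proof.
have v_neq0 : #|X|%:R != 0 :> F.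
  by rewrite pnatr_eq0 -lt0n; apply/card_gt0P; exists x.
pose A := \matrix_(i < #|X|, j < #|X|) w (enum_val i) (enum_val j).
pose B := \matrix_(i < #|X|, j < #|X|)
  (#|X|%:R^-1 / w (enum_val j) (enum_val i)).
have BA : B *m A = 1%:M.
  apply/matrixP=> i j; rewrite !mxE.
  under eq_bigr do rewrite !mxE -mulrA [_^-1 * w _ _]mulrC.
  rewrite -mulr_sumr.
  rewrite -(big_enum_val (fun x => w x (enum_val j) / w x (enum_val i))) /=.
  rewrite (wII.2 (enum_val j) (enum_val i)) (inj_eq enum_val_inj) eq_sym.
  by case: eqP => _; rewrite ?mulr0 // mulVf.
have /matrixP/(_ (enum_rank x) (enum_rank y)) := mulmx1C BA.
rewrite !mxE (inj_eq enum_rank_inj) => e.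
apply: (mulfI (invr_neq0 v_neq0)).
transitivity ((x == y)%:R : F); last first.
  by case: eqP => _; rewrite ?mulr0 // mulVf.
rewrite -e mulr_sumr.
rewrite (big_enum_val (fun c => #|X|%:R^-1 * (w x c / w y c))) /=.
by apply: eq_bigr => i _; rewrite !mxE !enum_rankK mulrCA.
Qed.

(** For fixed b the vectors Y_(a,b) span all functions. *)
Lemma quot_nondeg b h : (forall a, \sum_x h x * quot a b x = 0) ->
  forall x, h x = 0.
Proof.
move=> h0 x.
have v_neq0 : #|X|%:R != 0 :> F.
  by rewrite pnatr_eq0 -lt0n; apply/card_gt0P; exists x.
have : \sum_a (\sum_z h z * quot a b z) / w x a = 0.
  by rewrite big1 // => a _; rewrite h0 mul0r.
under eq_bigr do rewrite mulr_suml.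
rewrite exchange_big (eq_bigr (fun z =>
  h z / w z b * (if z == x then #|X|%:R else 0))) => [|z _]; last first.
  rewrite -typeII_dual mulr_sumr; apply: eq_bigr => a _.
  by rewrite /quot; ring.
rewrite (bigD1 x) //= big1 ?addr0 => [|z /negPf->]; last by rewrite mulr0.
rewrite eqxx => /eqP; rewrite !mulf_eq0 invr_eq0 (negPf v_neq0).
by rewrite (negPf (w_neq0 _ _)) !orbF => /eqP.
Qed.

End TypeII.

(** * Sums of one-coordinate functions *)

Section Additive.
Variables (F : numFieldType) (I T : finType).
Local Notation X := {ffun I -> T}.
Local Notation n := (#|I|%:R : F).
Local Notation q := (#|T|%:R : F).
Implicit Types (f g h : X -> F) (x y z : X) (i j k : I) (t : T).
Hypothesis T_gt0 : (0 < #|T|)%N.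
Let q_neq0 : q != 0 := cardT_neq0 F T_gt0.

Lemma cardX_neq0 : #|X|%:R != 0 :> F.
Proof. by rewrite card_ffun natrX expf_neq0. Qed.

Lemma sum_coord_mul0 i (ps : T -> F) (h : X -> F) :
  (forall x t, h (upd x i t) = h x) ->
  \sum_t ps t = 0 -> \sum_(x : X) ps (x i) * h x = 0.
Proof.
move=> hi ps0; apply: (@sum_eq0_line_sum F I T T_gt0 i) => x.
rewrite /line_sum; under eq_bigr do rewrite hi upd_at.
by rewrite -mulr_suml ps0 mul0r.
Qed.

Lemma sum_coord0 i (ps : T -> F) :
  \sum_t ps t = 0 -> \sum_(x : X) ps (x i) = 0.
Proof.
move=> ps0; rewrite -[RHS](@sum_coord_mul0 i ps (fun=> 1)) //.
by apply: eq_bigr => x _; rewrite mulr1.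
Qed.

Lemma coord_sum_upd al f i x t : coord_sum al f ->
  f (upd x i t) = f x - al i (x i) + al i t.
Proof.
move=> [_ fE]; rewrite !fE (bigD1 i) // [in RHS](bigD1 i) //= upd_at.
rewrite (eq_bigr (fun k => al k (x k))) => [|k ki]; first by ring.
by rewrite upd_ne.
Qed.

(** Freeze all coordinates but i and j.  The second differences of f and of 1/f
    in directions i, j vanish, which for s, s' and t, t' with different values
    forces f(s,t) + f(s',t') = 0 (R below).  Comparing these relations, the
    other coordinates contribute nothing, and al_i, al_j take two values each,
    with al_i s0 + al_i s1 = sg = - (al_j t0 + al_j t1).  Then 1/f is a multiple
    of al_i - al_j - sg, and the zero sums give sg = 0. *)
Lemma inverse_coord_sum al be f g i j s0 s1 t0 t1 :
    coord_sum al f -> coord_sum be g -> (forall x, f x * g x = 1) -> i != j ->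
    al i s0 != al i s1 -> al j t0 != al j t1 ->
  [/\ forall x, f x = al i (x i) + al j (x j),
      forall s, al i s ^+ 2 = al i s0 ^+ 2 & al i s0 != 0].
Proof.
move=> af ag fg ij als alt.
pose base x := f x - al i (x i) - al j (x j).
have f2 x s t : f (upd (upd x i s) j t) = base x + al i s + al j t.
  rewrite !(coord_sum_upd _ _ _ af) upd_ne 1?eq_sym // /base; ring.
have g2 x s t : g (upd (upd x i s) j t) =
    g x - be i (x i) - be j (x j) + be i s + be j t.
  rewrite !(coord_sum_upd _ _ _ ag) upd_ne 1?eq_sym //; ring.
have f_neq0 x : f x != 0.
  by apply/eqP=> fx0; have /eqP := fg x; rewrite fx0 mul0r eq_sym oner_eq0.
have gE x : g x = (f x)^-1.
  by apply: (mulfI (f_neq0 x)); rewrite fg divff.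
have R x s s' t t' : al i s != al i s' -> al j t != al j t' ->
    al i s + al i s' + al j t + al j t' + base x *+ 2 = 0.
  rewrite -subr_eq0 => nzs; rewrite -subr_eq0 => nzt.
  pose p s t := base x + al i s + al j t.
  have p_neq0 u v : p u v != 0 by rewrite /p -f2.
  have mixed : (p s t)^-1 + (p s' t')^-1 - (p s t')^-1 - (p s' t)^-1 = 0.
    by rewrite /p -!f2 -!gE !g2; ring.
  apply: (mulIf nzs); apply: (mulIf nzt); rewrite !mul0r.
  transitivity (p s t * p s' t' * p s t' * p s' t *
    ((p s t)^-1 + (p s' t')^-1 - (p s t')^-1 - (p s' t)^-1)).
    by move: (p_neq0 s t) (p_neq0 s' t') (p_neq0 s t') (p_neq0 s' t);
       rewrite /p => *; field; do ?[apply/andP; split].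
  by rewrite mixed mulr0.
have base_const x y : base x = base y.
  have two_neq0 : 2 != 0 :> F by rewrite pnatr_eq0.
  apply: (mulfI two_neq0).
  apply: (addrI (al i s0 + al i s1 + al j t0 + al j t1)).
  by rewrite !mulr_natl !R.
have base0 x : base x = 0.
  apply: (mulfI cardX_neq0); rewrite mulr0 mulr_natl -sumr_const.
  rewrite (eq_bigr base) => [|y _]; last exact: base_const.
  rewrite /base !sumrB (sum_coord_sum T_gt0 af).
  have s0al k : \sum_(x : X) al k (x k) = 0 by apply: sum_coord0; exact: af.1.
  by rewrite !s0al !subr0.
have fE x : f x = al i (x i) + al j (x j).
  by apply/eqP; rewrite -subr_eq0 opprD addrA -/(base x) base0.
have [x0 _] := ffun_point I T_gt0.
have R0 s s' t t' : al i s != al i s' -> al j t != al j t' ->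
    al i s + al i s' + al j t + al j t' = 0.
  by move=> ss tt; have := R x0 _ _ _ _ ss tt; rewrite base0 mul0rn addr0.
have e0 := R0 _ _ _ _ als alt.
have roots_i s : (al i s - al i s0) * (al i s - al i s1) = 0.
  have [->|ne] := eqVneq (al i s) (al i s0); first by rewrite subrr mul0r.
  have e1 := R0 _ _ _ _ ne alt.
  have -> : al i s - al i s1 = (al i s + al i s0 + al j t0 + al j t1)
    - (al i s0 + al i s1 + al j t0 + al j t1) by ring.
  by rewrite e0 e1 subrr mulr0.
have roots_j t : (al j t - al j t0) * (al j t - al j t1) = 0.
  have [->|ne] := eqVneq (al j t) (al j t0); first by rewrite subrr mul0r.
  have e1 := R0 _ _ _ _ als ne.
  have -> : al j t - al j t1 = (al i s0 + al i s1 + al j t + al j t0)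
    - (al i s0 + al i s1 + al j t0 + al j t1) by ring.
  by rewrite e0 e1 subrr mulr0.
(* The two values are the roots of X ^ 2 - sg X + al_i s0 al_i s1, and similarly
   for al_j with - sg; hence f (al_i - al_j - sg) is the constant d. *)
pose sg := al i s0 + al i s1.
pose d := al j t0 * al j t1 - al i s0 * al i s1.
have gd x : g x * d = al i (x i) - al j (x j) - sg.
  apply: (mulfI (f_neq0 x)); rewrite mulrA fg mul1r fE.
  apply/eqP; rewrite -subr_eq0; apply/eqP.
  transitivity ((al j (x j) - al j t0) * (al j (x j) - al j t1)
     - (al i (x i) - al i s0) * (al i (x i) - al i s1)
     + al j (x j) * (al i s0 + al i s1 + al j t0 + al j t1)).
    by rewrite /d /sg; ring.
  by rewrite roots_i roots_j e0 mulr0 subrr addr0.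
have sg0 : sg = 0.
  apply: (mulfI cardX_neq0); rewrite mulr0 mulr_natl -sumr_const.
  have s0al k : \sum_(x : X) al k (x k) = 0 by apply: sum_coord0; exact: af.1.
  rewrite (eq_bigr (fun x => al i (x i) - al j (x j) - g x * d)).
    by rewrite !sumrB !s0al -mulr_suml (sum_coord_sum T_gt0 ag) mul0r !subr0.
  by move=> x _; rewrite gd; ring.
have s1E : al i s1 = - al i s0.
  by apply/eqP; rewrite -addr_eq0 addrC -/sg sg0.
split=> // [s|].
  apply/eqP; rewrite -subr_eq0; apply/eqP.
  by rewrite -[RHS](roots_i s) s1E; ring.
by apply: contraNneq als; rewrite s1E => ->; rewrite oppr0.
Qed.

(** Write A, B for the two summands of f, and H_k for those of h.  Expanding the
    line sums of h f gives, with nu = mu - q (n - 2) and a constant C,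
    C + q (A H_i + B H_j) = nu h f.  If nu = 0, then A H_i is constant in x_i,
    and A ^ 2 is a nonzero constant.  Otherwise h f is a function of x_i plus a
    function of x_j, and its second difference in directions i, j vanishes,
    which makes the differences of H_i proportional to those of A. *)
Lemma coord_sum_mul_eigen (al be : T -> F) hs f h i j mu c t0 t1 :
    i != j -> \sum_t al t = 0 -> \sum_t be t = 0 ->
    (forall x, f x = al (x i) + be (x j)) -> coord_sum hs h ->
    hamming_eigen mu (fun x => h x * f x) ->
    (forall s, al s ^+ 2 = c) -> c != 0 -> be t0 != be t1 ->
  exists kap : F, forall s, hs i s = kap * al s.
Proof.
move=> ij al0 be0 fE ah em alc c_neq0 bet.
have hsum k : \sum_t hs k t = 0 by apply: ah.1.
have hE x : h x = \sum_k hs k (x k) by apply: ah.2.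
have Li x : line_sum i (fun x => h x * f x) x =
    \sum_t al t * hs i t + q * (be (x j) * (h x - hs i (x i))).
  rewrite /line_sum (eq_bigr (fun t => al t * hs i t
     + al t * (h x - hs i (x i)) + hs i t * be (x j)
     + be (x j) * (h x - hs i (x i)))); last first.
    move=> t _; rewrite fE (coord_sum_upd _ _ _ ah) upd_at upd_ne 1?eq_sym //.
    by ring.
  rewrite !big_split /= sumr_const mulr_natl -!mulr_suml al0 hsum.
  by rewrite !mul0r !addr0.
have Lj x : line_sum j (fun x => h x * f x) x =
    \sum_t be t * hs j t + q * (al (x i) * (h x - hs j (x j))).
  rewrite /line_sum (eq_bigr (fun t => be t * hs j t
     + be t * (h x - hs j (x j)) + hs j t * al (x i)
     + al (x i) * (h x - hs j (x j)))); last first.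
    move=> t _; rewrite fE (coord_sum_upd _ _ _ ah) upd_at upd_ne //.
    by ring.
  rewrite !big_split /= sumr_const mulr_natl -!mulr_suml be0 hsum.
  by rewrite !mul0r !addr0.
have Lk k x : k != i -> k != j -> line_sum k (fun x => h x * f x) x =
    q * f x * (h x - hs k (x k)).
  move=> ki kj; rewrite /line_sum (eq_bigr (fun t => hs k t * f x
     + f x * (h x - hs k (x k)))); last first.
    move=> t _; rewrite !fE (coord_sum_upd _ _ _ ah) !upd_ne 1?eq_sym //.
    by ring.
  by rewrite big_split /= sumr_const -mulr_suml hsum mul0r add0r
     -[LHS]mulr_natl mulrA.
pose nu := mu - q * (n - 2).
pose C := \sum_t al t * hs i t + \sum_t be t * hs j t.
have E x : C + q * (al (x i) * hs i (x i) + be (x j) * hs j (x j)) =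
    nu * (h x * f x).
  have := em x; rewrite (bigD1 i) // (bigD1 j) 1?eq_sym //= Li Lj.
  rewrite (eq_bigr (fun k => q * f x * (h x - hs k (x k)))); last first.
    by move=> k /andP[ki kj]; exact: Lk.
  rewrite -mulr_sumr sumrB sumr_const.
  have -> : \sum_(k | (k != i) && (k != j)) hs k (x k) =
      h x - hs i (x i) - hs j (x j).
    by rewrite hE [in RHS](bigD1 i) // [in RHS](bigD1 j) 1?eq_sym //=; ring.
  have -> : h x *+ #|(fun k => (k != i) && (k != j))| = (n - 2) * h x.
    by rewrite -(card_outside2 F ij) mulr_natl.
  by move=> emx; rewrite /nu [RHS]mulrBl -emx /C fE; ring.
have [x0 _] := ffun_point I T_gt0.
have [nu0|nu_neq0] := eqVneq nu 0.
  exists (al (x0 i) * hs i (x0 i) / c) => s.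
  have := E (upd x0 i s); rewrite nu0 mul0r -(mul0r (h x0 * f x0)) -nu0 -E.
  rewrite upd_at upd_ne 1?eq_sym // => /addrI/(mulfI q_neq0)/addIr <-.
  by transitivity (hs i s * (al s ^+ 2 / c)); [rewrite alc divff ?mulr1|ring].
pose k0 := (hs j t1 - hs j t0) / (be t0 - be t1).
have bet' : be t0 - be t1 != 0 by rewrite subr_eq0.
have D s s' : hs i s - hs i s' = k0 * (al s - al s').
  have E2 u v := E (upd (upd x0 i u) j v).
  pose r := h x0 - hs i (x0 i) - hs j (x0 j).
  have H2 u v : h (upd (upd x0 i u) j v) = r + hs i u + hs j v.
    rewrite !(coord_sum_upd _ _ _ ah) upd_ne 1?eq_sym // /r; ring.
  have F2 u v : C + q * (al u * hs i u + be v * hs j v) =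
      nu * ((r + hs i u + hs j v) * (al u + be v)).
    have := E2 u v; rewrite fE upd_at H2 upd_ne // upd_at; exact.
  apply: (mulfI bet'); apply: (mulfI nu_neq0); rewrite /k0.
  apply/eqP; rewrite -subr_eq0; apply/eqP.
  transitivity (nu * ((r + hs i s + hs j t0) * (al s + be t0))
     - nu * ((r + hs i s' + hs j t0) * (al s' + be t0))
     - nu * ((r + hs i s + hs j t1) * (al s + be t1))
     + nu * ((r + hs i s' + hs j t1) * (al s' + be t1))).
    by field.
  by rewrite -!F2; ring.
exists k0 => s; apply: (mulfI q_neq0).
transitivity (\sum_(s' : T) (hs i s - hs i s')).
  by rewrite sumrB hsum subr0 sumr_const mulr_natl.
under eq_bigr do rewrite D.
by rewrite -mulr_sumr sumrB al0 subr0 sumr_const mulrCA mulr_natl.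
Qed.

End Additive.

(** * Type II matrices whose quotients are Hamming eigenvectors *)

Section HammingTypeII.
Variables (F : numFieldType) (I T : finType).
Local Notation X := {ffun I -> T}.
Local Notation n := (#|I|%:R : F).
Local Notation q := (#|T|%:R : F).
Implicit Types (a b c x y z : X) (i j k : I) (t : T).
Variable w : X -> X -> F.
Local Notation Y := (quot w).
Local Notation wt1 := (hamming_eigen (weight1_value F I T)).
Hypothesis T_gt2 : (2 < #|T|)%N.
Hypothesis wII : typeII w.
Hypothesis wH : forall a b, exists mu, hamming_eigen mu (Y a b).

Let T_gt0 : (0 < #|T|)%N. Proof. by case: #|T| T_gt2. Qed.
Let q_neq0 : q != 0 := cardT_neq0 F T_gt0.
Let Y_neq0 := quot_neq0 wII.

Lemma sum_quotV a b : \sum_x Y a b x * Y b a x = #|X|%:R.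
Proof. by under eq_bigr do rewrite quotM // quot_id //; rewrite sumr_const. Qed.

(** Eigenvectors for different eigenvalues are orthogonal, and Y_(a,b), Y_(b,a)
    are not. *)
Lemma hamming_eigen_quotC a b mu :
  hamming_eigen mu (Y a b) -> hamming_eigen mu (Y b a).
Proof.
move=> eab; have [nu eba] := wH b a.
have [->//|ne] := eqVneq mu nu.
have := hamming_eigen_ortho T_gt0 eab eba ne; rewrite sum_quotV => /eqP.
by rewrite (negPf (cardX_neq0 _ _ T_gt0)).
Qed.

(** The Y_(a,b) of other eigenvalues are orthogonal to h anyway. *)
Lemma weight1_nondeg b h : wt1 h ->
  (forall a, wt1 (Y a b) -> \sum_x h x * Y a b x = 0) -> forall x, h x = 0.
Proof.
move=> eh h0; apply: (quot_nondeg wII (b := b)) => a.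
have [mu ea] := wH a b.
have [muE|ne] := eqVneq (weight1_value F I T) mu.
  by apply: h0; rewrite muE.
exact: hamming_eigen_ortho eh ea ne.
Qed.

Lemma weight1_coord i (ps : T -> F) : \sum_t ps t = 0 ->
  wt1 (fun x => ps (x i)).
Proof.
move=> ps0 x; rewrite (bigD1 i) //= (eq_bigr (fun=> q * ps (x i))).
  rewrite sumr_const /line_sum; under eq_bigr do rewrite upd_at.
  rewrite ps0 add0r -[LHS]mulr_natl /weight1_value.
  have -> : #|I| = #|[pred k | k != i]|.+1.
    by rewrite -!sum1_card (bigD1 i).
  by rewrite -addn1 natrD addrK; ring.
by move=> k ki; rewrite line_sum_inv // => t; rewrite upd_ne // eq_sym.
Qed.

(** Were two coordinates i, j involved, all weight one Y_(c,b) would have their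
    i-th part proportional to al_i.  As q >= 3, there is a nonzero function ps
    on T, supported on three points, of sum zero and orthogonal to al_i; then
    ps (x_i) has weight one and is orthogonal to all these Y_(c,b), against
    weight1_nondeg. *)
Lemma no_two_coords al a b i j s0 s1 t0 t1 :
    wt1 (Y b a) -> coord_sum al (Y b a) -> i != j ->
    al i s0 != al i s1 -> al j t0 = al j t1.
Proof.
move=> eba aba ij als; apply/eqP; apply/idPn => alt.
have [be bab] := weight1_coord_sum T_gt0 (hamming_eigen_quotC eba).
have fg x : Y b a x * Y a b x = 1 by rewrite quotM // quot_id.
have [fE al2 al_neq0] := inverse_coord_sum T_gt0 aba bab fg ij als alt.
have [s2 s20 s21] : exists2 s2, s2 != s0 & s2 != s1.
  have : (0 < #|~: [set s0; s1]|)%N.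
    have := T_gt2; rewrite -subn_gt0 => /leq_trans; apply.
    rewrite leq_subLR -(cardsC [set s0; s1]) leq_add2r cards2.
    by case: (_ != _).
  by case/card_gt0P=> s2; rewrite !inE => /norP[? ?]; exists s2.
have s10 : s1 != s0 by apply: contraNneq als => ->.
(* the cross product of (1, 1, 1) with the values of al_i at s0, s1, s2 *)
pose ps s := if s == s0 then al i s1 - al i s2 else
  if s == s1 then al i s2 - al i s0 else
  if s == s2 then al i s0 - al i s1 else 0.
have psE (ga : T -> F) : \sum_s ps s * ga s = (al i s1 - al i s2) * ga s0
    + (al i s2 - al i s0) * ga s1 + (al i s0 - al i s1) * ga s2.
  rewrite (bigD1 s0) // (bigD1 s1) // (bigD1 s2) /= ?s20 ?s21 //.
  rewrite big1 => [|s /andP[/andP[/negPf n0 /negPf n1] /negPf n2]].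
    by rewrite /ps !eqxx (negPf s10) (negPf s20) (negPf s21); ring.
  by rewrite /ps n0 n1 n2 mul0r.
have ps0 : \sum_s ps s = 0.
  transitivity (\sum_s ps s * 1); first by under [RHS]eq_bigr do rewrite mulr1.
  by rewrite psE; ring.
have : forall x : X, ps (x i) = 0.
  apply: (@weight1_nondeg b); first exact: weight1_coord.
  move=> c ecb; have [hs hcb] := weight1_coord_sum T_gt0 ecb.
  have [mu eca] := wH c a.
  have em : hamming_eigen mu (fun x => Y c b x * Y b a x).
    move=> x; rewrite -[RHS]/(mu * _) quotM // -eca; apply: eq_bigr => k _.
    by apply: eq_line_sum => y; rewrite quotM.
  have c_neq0 : al i s0 ^+ 2 != 0 by rewrite expf_neq0.
  have [kap hk] := coord_sum_mul_eigen T_gt0 ij (aba.1 i) (aba.1 j) fE hcb em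
    al2 c_neq0 alt.
  under eq_bigr do rewrite hcb.2 mulr_sumr.
  rewrite exchange_big big1 // => k _.
  have [->|ki] := eqVneq k i.
    apply: (@sum_coord0 F I T T_gt0 i (fun t => ps t * hs i t)).
    by rewrite psE !hk; ring.
  apply: (sum_coord_mul0 T_gt0 (h := fun x : X => hs k (x k))) => // x t.
  by rewrite upd_ne.
have [x0 _] := ffun_point I T_gt0.
move=> /(_ (upd x0 i s2)); rewrite upd_at /ps eqxx (negPf s20) (negPf s21).
by move=> /eqP; rewrite subr_eq0 (negPf als).
Qed.

Definition only_on i (f : X -> F) : bool :=
  [forall x : X, forall y : X, (x i == y i) ==> (f x == f y)].

Lemma only_onP i f : reflect (forall x y, x i = y i -> f x = f y) (only_on i f).
Proof.
apply: (iffP idP) => [/'forall_forallP df x y xy|df].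
  by move/implyP: (df x y) => /(_ (introT eqP xy))/eqP.
by apply/'forall_forallP=> x y; apply/implyP=> /eqP/df->.
Qed.

Lemma weight1_only_on a b : wt1 (Y a b) -> exists i, only_on i (Y a b).
Proof.
move=> eab; have [al aab] := weight1_coord_sum T_gt0 eab.
have [x0 _] := ffun_point I T_gt0.
have [i ali] : exists i, al i (x0 i) != 0.
  apply/existsP; apply: contraTT (Y_neq0 a b x0); rewrite negb_exists negbK.
  move=> /forallP al0; rewrite aab.2 big1 // => i _.
  by apply/eqP; rewrite -[_ == _]negbK al0.
exists i; have [s als] : exists s, al i (x0 i) != al i s.
  apply/existsP; apply: contraNT ali; rewrite negb_exists => /forallP al0.
  rewrite -(mulrI_eq0 _ (mulfI q_neq0)) mulr_natl -sumr_const.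
  rewrite -[X in _ == X](aab.1 i); apply/eqP; apply: eq_bigr => s _.
  by apply/eqP; rewrite -[_ == _]negbK al0.
apply/only_onP=> x y xy; rewrite !aab.2; apply: eq_bigr => k _.
have [<-|ki] := eqVneq i k; first by rewrite xy.
exact: no_two_coords eab aab ki als.
Qed.

End HammingTypeII.

(** * Columns that differ from a given one in a single coordinate *)

Section Classes.
Variables (F : numFieldType) (I T : finType).
Local Notation X := {ffun I -> T}.
Local Notation n := (#|I|%:R : F).
Local Notation q := (#|T|%:R : F).
Implicit Types (a b c x y z : X) (i j k : I) (t : T).
Variable w : X -> X -> F.
Local Notation Y := (quot w).
Local Notation wt1 := (hamming_eigen (weight1_value F I T)).
Hypothesis T_gt2 : (2 < #|T|)%N.
Hypothesis wII : typeII w.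
Hypothesis wH : forall a b, exists mu, hamming_eigen mu (Y a b).

Let T_gt0 : (0 < #|T|)%N. Proof. by case: #|T| T_gt2. Qed.
Let q_neq0 : q != 0 := cardT_neq0 F T_gt0.
Let Y_neq0 := quot_neq0 wII.

Local Notation diag t := ([ffun=> t] : X).

Lemma only_on_diag i f x : only_on i f -> f x = f (diag (x i)) :> F.
Proof. by move/only_onP; apply; rewrite ffunE. Qed.

Lemma only_on_upd i k f x t : only_on i f -> k != i -> f (upd x k t) = f x :> F.
Proof. by move=> /only_onP df ki; apply: df; rewrite upd_ne // eq_sym. Qed.

Lemma only_on_id i b : only_on i (Y b b).
Proof. by apply/only_onP=> x y _; rewrite !quot_id. Qed.

Lemma only_on_sym i a b : only_on i (Y a b) -> only_on i (Y b a).
Proof.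
by move/only_onP=> d; apply/only_onP=> x y /d; rewrite -!(quotV w a) => ->.
Qed.

Lemma only_on_trans i a b c :
  only_on i (Y a b) -> only_on i (Y b c) -> only_on i (Y a c).
Proof.
move=> /only_onP d1 /only_onP d2; apply/only_onP=> x y xy.
by rewrite -!(quotM wII a b c) (d1 x y) // (d2 x y).
Qed.

Lemma sum_only_on i f : only_on i f ->
  q * \sum_x f x = #|X|%:R * \sum_t f (diag t).
Proof.
move=> df; rewrite -(sum_line_sum i) mulr_natl -sumr_const.
apply: eq_bigr => x _.
by apply: eq_bigr => t _; rewrite (only_on_diag _ df) upd_at.
Qed.

Lemma only_on_ortho i a b :
  only_on i (Y a b) -> \sum_t Y a b (diag t) = if a == b then q else 0.
Proof.
move=> /sum_only_on e; apply: (mulfI (cardX_neq0 F I T_gt0)); rewrite -e wII.2.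
by case: eqP; rewrite ?mulr0 // mulrC.
Qed.

(** The quotients Y_(a,b) depending on x_i alone span all functions of x_i.  The
    hypothesis at a = b says that ps has sum zero, so ps (x_i) has weight one; a
    weight one Y_(a,b) that depends on another coordinate is orthogonal to
    functions of x_i of sum zero, and the other ones belong to different
    eigenvalues. *)
Lemma only_on_nondeg i b (ps : T -> F) :
    (forall a, only_on i (Y a b) -> \sum_t ps t * Y a b (diag t) = 0) ->
  forall t, ps t = 0.
Proof.
move=> psY t.
have ps0 : \sum_t ps t = 0.
  rewrite -[RHS](psY b (only_on_id i b)); apply: eq_bigr => s _.
  by rewrite quot_id // mulr1.
suff /(_ (diag t)) : forall x : X, ps (x i) = 0 by rewrite ffunE.
apply: (weight1_nondeg T_gt2 wII wH (b := b)); first exact: weight1_coord.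
move=> a eab; have [k dk] := weight1_only_on T_gt2 wII wH eab.
have [ki|ki] := eqVneq k i.
  rewrite ki in dk; under eq_bigr do rewrite (only_on_diag _ dk).
  apply: (@sum_coord0 F I T T_gt0 i (fun t => ps t * Y a b (diag t))).
  exact: psY.
by apply: sum_coord_mul0 => // x s; rewrite (only_on_upd _ _ dk) // eq_sym.
Qed.

(** The dual orthogonality relation for the class of b, with only_on_nondeg in
    place of the inversion of a square matrix, since the class is not yet known
    to have q elements. *)
Lemma only_on_complete i b s t :
  \sum_(a | only_on i (Y a b)) Y a b (diag s) * Y b a (diag t) =
    if s == t then q else 0.
Proof.
apply/eqP; rewrite -subr_eq0; apply/eqP; move: t.
apply: (@only_on_nondeg i b) => a' da'.
under eq_bigr do rewrite mulrBl mulr_suml.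
rewrite sumrB exchange_big /=.
rewrite [X in _ - X](bigD1 s) //= eqxx.
rewrite [X in _ - (_ + X)]big1 => [|t]; last first.
  by rewrite eq_sym => /negPf->; rewrite mul0r.
rewrite addr0 (eq_bigr (fun a => Y a b (diag s) * if a' == a then q else 0)).
  rewrite (bigD1 a') //= eqxx big1 ?addr0 => [|a /andP[_ /negPf aa]].
    by rewrite mulrC subrr.
  by rewrite eq_sym aa mulr0.
move=> a da; rewrite -(@only_on_ortho i a' a); last first.
  exact: only_on_trans da' (only_on_sym da).
rewrite mulr_sumr; apply: eq_bigr => t _; rewrite -mulrA; congr (_ * _).
by rewrite mulrC quotM.
Qed.

(** Both sides count the sum over t of the diagonal case of only_on_complete. *)
Lemma card_only_on i b : #|[pred a | only_on i (Y a b)]| = #|T|.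
Proof.
apply/eqP; rewrite -(eqr_nat F); apply/eqP; apply: (mulfI q_neq0).
transitivity (\sum_(a | only_on i (Y a b)) q).
  by rewrite sumr_const mulr_natr.
transitivity (\sum_t \sum_(a | only_on i (Y a b))
  Y a b (diag t) * Y b a (diag t)).
  rewrite exchange_big; apply: eq_bigr => a _.
  by under [RHS]eq_bigr do rewrite quotM // quot_id //; rewrite sumr_const.
by under eq_bigr do rewrite only_on_complete eqxx; rewrite sumr_const mulr_natr.
Qed.

Lemma sum_only_on_line_sum i b c x :
  \sum_(a | only_on i (Y a b)) Y a b x * line_sum i (Y c a) x = q * Y c b x.
Proof.
transitivity (\sum_t Y c b (upd x i t) * if x i == t then q else 0).
  under eq_bigr do rewrite mulr_sumr.
  rewrite exchange_big; apply: eq_bigr => t _.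
  rewrite -(only_on_complete i b) mulr_sumr; apply: eq_bigr => a da.
  rewrite -(quotM wII c b a) (only_on_diag x da) mulrCA.
  by rewrite [Y b a _](only_on_diag _ (only_on_sym da)) upd_at.
rewrite (bigD1 (x i)) //= eqxx upd_same mulrC big1 ?addr0 // => t /negPf.
by rewrite eq_sym => ->; rewrite mulr0.
Qed.

(** For a in the class of b, multiplication by Y_(b,a) commutes with J_k for
    k <> i.  Eliminating these J_k from the eigenvector equations of Y_(c,b)
    and Y_(c,a) leaves
    Y_(a,b) J_i Y_(c,a) - J_i Y_(c,b) = (mu_a - mu_b) Y_(c,b); the sum over the
    class is evaluated by sum_only_on_line_sum. *)
Lemma quot_line_sum_eigen i b c :
  exists mu, forall x, line_sum i (Y c b) x = mu * Y c b x.
Proof.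
have [mu emu] : exists mu : X -> F, forall a, hamming_eigen (mu a) (Y c a).
  exact: fin_all_exists (wH c).
exists (1 - q^-1 * \sum_(a | only_on i (Y a b)) (mu a - mu b)) => x.
apply: (mulfI q_neq0); rewrite mulrA mulrBr mulVKf // mulr1 mulrBl.
rewrite -(sum_only_on_line_sum i) mulr_suml -sumrB.
transitivity (\sum_(a | only_on i (Y a b)) line_sum i (Y c b) x).
  by rewrite sumr_const card_only_on mulr_natl.
apply: eq_bigr => a da.
have lk k : k != i -> line_sum k (Y c a) x = line_sum k (Y c b) x * Y b a x.
  move=> ki; rewrite /line_sum mulr_suml; apply: eq_bigr => t _.
  by rewrite -(quotM wII c b a) [Y b a _](only_on_upd _ _ (only_on_sym da) ki).
have ea : mu a * Y c a x = line_sum i (Y c a) x +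
    (mu b * Y c b x - line_sum i (Y c b) x) * Y b a x.
  rewrite -!emu (bigD1 i) //= (eq_bigr _ lk) -mulr_suml.
  by rewrite [in RHS](bigD1 i) //=; ring.
have -> : line_sum i (Y c a) x = mu a * Y c a x -
    (mu b * Y c b x - line_sum i (Y c b) x) * Y b a x by rewrite ea; ring.
have := quotM wII c b a x; have := quotM wII a b a x.
rewrite quot_id // => e1 <-.
transitivity ((1 - Y a b x * Y b a x) *
  ((mu b - mu a) * Y c b x - line_sum i (Y c b) x) + line_sum i (Y c b) x);
  last by ring.
by rewrite e1 subrr mul0r add0r.
Qed.

(** Y_(c,a) is an eigenvector of J_i, so it is constant in x_i as soon as one of
    its line sums is nonzero, and by sum_only_on_line_sum these do not vanish
    for all a of the class. *)
Lemma only_on_const i b c : exists2 a, only_on i (Y a b) &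
  forall x t, Y c a (upd x i t) = Y c a x.
Proof.
have [t0 _] : exists t, t \in T by apply/card_gt0P.
pose x0 := diag t0.
have /existsP[a /andP[da la]] :
    [exists a, only_on i (Y a b) && (line_sum i (Y c a) x0 != 0)].
  rewrite -[X in is_true X]negbK negb_exists; apply/negP=> /forallP no.
  have /eqP := sum_only_on_line_sum i b c x0.
  rewrite big1 => [|a da]; last first.
    by have := no a; rewrite da /= negbK => /eqP->; rewrite mulr0.
  by rewrite eq_sym mulf_eq0 (negPf q_neq0) (negPf (Y_neq0 _ _ _)).
exists a => // x t; have [mu lE] := quot_line_sum_eigen i a c.
have mu_neq0 : mu != 0 by apply: contraNneq la => m0; rewrite lE m0 mul0r.
by apply: (mulfI mu_neq0); rewrite -!lE line_sum_upd.
Qed.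

(** The letter s c i is the one for which the quotient of column c by the member
    e i (s c i) of the i-th class of b is constant in x_i.  Two columns with the
    same word s c would be proportional, which a type II matrix excludes. *)
Lemma tensor_structure :
  exists (u : I -> T -> T -> F) (s : X -> X) (kap : X -> F) b,
  [/\ forall i, typeII (u i), injective s, forall c, kap c != 0 &
      forall x c, w x c = w x b * kap c * \prod_i u i (x i) (s c i)].
Proof.
have [t0 _] : exists t, t \in T by apply/card_gt0P.
pose b := diag t0.
have [e [eP eI]] : exists e : I -> T -> X,
    (forall i t, only_on i (Y (e i t) b)) /\
    (forall i, injective (e i) /\
      forall a, only_on i (Y a b) -> exists t, a = e i t).
  have E i : #|T| = #|[pred a | only_on i (Y a b)]| by rewrite card_only_on.
  exists (fun i t => enum_val (cast_ord (E i) (enum_rank t))); split=> [i t|i].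
    exact: (enum_valP (A := [pred a | only_on i (Y a b)])).
  split=> [t t'|a da].
    by move=> /enum_val_inj/cast_ord_inj/enum_rank_inj.
  pose r := enum_rank_in (A := [pred a | only_on i (Y a b)]) da a.
  exists (enum_val (cast_ord (esym (E i)) r)).
  rewrite enum_valK; rewrite (_ : cast_ord _ _ = r) ?enum_rankK_in //.
  exact: val_inj.
pose u i t s := Y (e i s) b (diag t).
have uII i : typeII (u i).
  split=> [t s|s s']; first exact: Y_neq0.
  rewrite -(inj_eq (eI i).1) -(@only_on_ortho i); last first.
    exact: only_on_trans (eP i s) (only_on_sym (eP i s')).
  by apply: eq_bigr => t _; rewrite /u quotV quotM.
have [s sP] : exists s : X -> X, forall c i x t,
    Y c (e i (s c i)) (upd x i t) = Y c (e i (s c i)) x.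
  pose good c i t := forall x r, Y c (e i t) (upd x i r) = Y c (e i t) x.
  apply: (@fin_all_exists _ (fun=> X)
    (fun c r => forall i, good c i (r i))) => c.
  have [r rP] : exists r : I -> T, forall i, good c i (r i).
    apply: (@fin_all_exists _ (fun=> T) (good c)) => i.
    have [a da ca] := only_on_const i b c.
    by have [t aE] := (eI i).2 a da; exists t; rewrite /good -aE.
  by exists (finfun r) => i; rewrite ffunE.
(* D c is constant in each coordinate, hence constant. *)
pose D c x := Y c b x / \prod_k u k (x k) (s c k).
have u_neq0 c x : \prod_k u k (x k) (s c k) != 0.
  by apply/prodf_neq0 => k _; exact: Y_neq0.
have D_neq0 c x : D c x != 0 by rewrite mulf_neq0 ?invr_eq0 ?u_neq0.
have DE c x y : D c x = D c y.
  apply: (@invariant_upd I T F predT) => // {}x i t _.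
  have Di z : D c z =
      Y c (e i (s c i)) z / \prod_(k | k != i) u k (z k) (s c k).
    have uE : u i (z i) (s c i) = Y (e i (s c i)) b z.
      by rewrite (only_on_diag z (eP i (s c i))).
    rewrite /D -(quotM wII c (e i (s c i)) b) (bigD1 i) //= uE invfM mulrA.
    by rewrite mulfK.
  rewrite !Di sP; congr (_ / _); apply: eq_bigr => k ki; by rewrite upd_ne.
have wE x c : w x c = w x b * D c b * \prod_i u i (x i) (s c i).
  by rewrite (DE c b x) /D -mulrA divfK // /quot mulrC divfK // (w_neq0 wII).
exists u, s, (fun c => D c b), b; split=> // c c' ss.
apply/eqP; apply/idPn => cc'.
have := wII.2 c c'; rewrite (negPf cc').
rewrite (eq_bigr (fun=> D c b / D c' b)) => [|x _]; last first.
  rewrite (wE x c) (wE x c') ss; have := u_neq0 c' x; have := w_neq0 wII x b.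
  by have := D_neq0 c' b => *; field; do ?[apply/andP; split].
rewrite sumr_const -[LHS]mulr_natl; apply/eqP.
rewrite mulf_neq0 ?(cardX_neq0 F I T_gt0) //.
by apply: mulf_neq0; rewrite ?invr_eq0 D_neq0.
Qed.

End Classes.

(** * Nomura algebras of tensor products *)

(** The Nomura algebra for matrices with arbitrary finite index type; the
    quotients of a type II matrix are nonzero, so only the eigenvector equation
    is recorded. *)
Definition nomuraf (F : numFieldType) (X : finType) (w M : X -> X -> F) :=
  forall a b, exists lam, forall x,
    \sum_z M x z * quot w a b z = lam * quot w a b x.

Section Tensor.
Variables (F : numFieldType) (I T : finType).
Local Notation X := {ffun I -> T}.
Local Notation q := (#|T|%:R : F).
Variable u : I -> T -> T -> F.
Hypothesis uII : forall i, typeII (u i).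
Hypothesis T_gt0 : (0 < #|T|)%N.

Definition tensor (A : I -> T -> T -> F) (x y : X) := \prod_i A i (x i) (y i).

Lemma quot_tensor c d x :
  quot (tensor u) c d x = \prod_i quot (u i) (c i) (d i) (x i).
Proof. by rewrite /quot /tensor prodf_div. Qed.

Lemma tensor_typeII : typeII (tensor u).
Proof.
split=> [x c|c d]; first by apply/prodf_neq0 => i _; exact: w_neq0.
under eq_bigr do rewrite -[_ / _]/(quot _ _ _ _) quot_tensor.
rewrite -(bigA_distr_bigA (fun i t => quot (u i) (c i) (d i) t)) /=.
rewrite (eq_bigr (fun i => if c i == d i then q else 0)); last first.
  by move=> i _; rewrite -(uII i).2.
case: eqVneq => [->|cd].
  by under eq_bigr do rewrite eqxx; rewrite prodr_const card_ffun natrX.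
have [i cdi] := ffun_neqP cd.
by rewrite (bigD1 i) //= (negPf cdi) mul0r.
Qed.

Lemma nomuraf_tensor (A : I -> T -> T -> F) :
  (forall i, nomuraf (u i) (A i)) -> nomuraf (tensor u) (tensor A).
Proof.
move=> nA c d.
pose ph i := quot (u i) (c i) (d i).
have [lam lamE] : exists lam : I -> F, forall i t,
    \sum_s A i t s * ph i s = lam i * ph i t.
  apply: (@fin_all_exists _ (fun=> F) (fun i l => forall t,
    \sum_s A i t s * ph i s = l * ph i t)).
  by move=> i; exact: nA.
exists (\prod_i lam i) => x; rewrite quot_tensor -big_split /=.
under [RHS]eq_bigr do rewrite -lamE.
rewrite bigA_distr_bigA; apply: eq_bigr => z _.
by rewrite quot_tensor -big_split.
Qed.

(** The slice S maps ph = Y_(a,b) of the factor u i to a multiple of itself iff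
    (S ph)(s) ph(s') is symmetric in s, s' (cross).  By quot_nondeg it is
    enough to test the difference, as a function of the column word, against
    the quotients Y_(c,z): when c_i <> z_i, such a quotient has zero line sums
    in direction i; when c_i = z_i, its product with ph is again a quotient of
    the tensor product, to which the hypothesis on M applies. *)
Lemma nomuraf_slice M i x z : nomuraf (tensor u) M ->
  nomuraf (u i) (fun s t => M (upd x i s) (upd z i t)).
Proof.
move=> nM a b; pose ph := quot (u i) a b.
have ph_neq0 t : ph t != 0 by exact: quot_neq0.
have quot_upd (c d y : X) : c i = d i ->
    quot (tensor u) (upd c i a) (upd d i b) y =
      ph (y i) * quot (tensor u) c d y.
  move=> cd; rewrite !quot_tensor (bigD1 i) // [in RHS](bigD1 i) //=.
  rewrite !upd_at cd quot_id // mul1r; congr (_ * _).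
  by apply: eq_bigr => k ki; rewrite !upd_ne.
have cross s s' :
    (\sum_t M (upd x i s) (upd z i t) * ph t) * ph s' =
    (\sum_t M (upd x i s') (upd z i t) * ph t) * ph s.
  pose g y := (M (upd x i s) y * ph s' - M (upd x i s') y * ph s) * ph (y i).
  suff /(_ z) : forall y, line_sum i g y = 0.
    rewrite /line_sum /g => e; apply/eqP; rewrite -subr_eq0 -[X in _ == X]e.
    rewrite !mulr_suml -sumrB; apply/eqP; apply: eq_bigr => t _.
    by rewrite upd_at; ring.
  apply: (quot_nondeg tensor_typeII (b := z)) => c.
  rewrite line_sum_sym //; have [cz|cz] := eqVneq (c i) (z i); last first.
    rewrite big1 // => y _; rewrite /line_sum.
    rewrite (eq_bigr (fun t => quot (u i) (c i) (z i) t *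
      \prod_(k | k != i) quot (u k) (c k) (z k) (y k))) => [|t _].
      by rewrite -mulr_suml (uII i).2 (negPf cz) mul0r mulr0.
    rewrite quot_tensor (bigD1 i) //= upd_at; congr (_ * _).
    by apply: eq_bigr => k ki; rewrite upd_ne.
  have inv y t : quot (tensor u) c z (upd y i t) = quot (tensor u) c z y.
    rewrite !quot_tensor (bigD1 i) // [in RHS](bigD1 i) //= cz !quot_id //.
    by congr (_ * _); apply: eq_bigr => k ki; rewrite upd_ne.
  have [lam lamE] := nM (upd c i a) (upd z i b).
  have half r r' :
      \sum_y M (upd x i r) y * ph r' * ph (y i) * quot (tensor u) c z y =
      ph r' * (lam * (ph r * quot (tensor u) c z x)).
    rewrite -(inv x r) -{2}(upd_at x i r) -quot_upd // -lamE mulr_sumr.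
    by apply: eq_bigr => y _; rewrite quot_upd //; ring.
  under eq_bigr do rewrite line_sum_inv // mulrCA.
  rewrite -mulr_sumr /g; under eq_bigr do rewrite 2!mulrBl.
  by rewrite sumrB !half; ring.
pose s0 := x i.
exists ((\sum_t M (upd x i s0) (upd z i t) * ph t) / ph s0) => s.
by apply: (mulIf (ph_neq0 s0)); rewrite mulrAC divfK // cross mulrC.
Qed.

End Tensor.

(** The identity holds with the kernels p i replaced by Kronecker deltas, and
    the deltas are exchanged for p i one coordinate at a time: under the sum
    over the line in direction i both have the same effect on m. *)
Lemma tensor_expand (F : numFieldType) (I Z : finType)
    (p : I -> Z -> Z -> F) (m : {ffun I -> Z} -> F) :
    (forall z i t, \sum_r m (upd z i r) * p i r t = m (upd z i t)) ->
  forall w, m w = \sum_z m z * \prod_i p i (z i) (w i).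
Proof.
move=> mp w.
have [Z0|Z_gt0] := posnP #|Z|.
  rewrite [RHS](eq_bigr (fun z => (z == w)%:R * m z)) => [|z _].
    rewrite (bigD1 w) //= eqxx mul1r big1 ?addr0 // => z /negPf->.
    by rewrite mul0r.
  have noI (i : I) : False.
    by have := card0_eq Z0 (z i); rewrite inE.
  rewrite big1 => [|i]; last by case: (noI i).
  rewrite (_ : z = w) ?eqxx ?mulr1 ?mul1r //.
  by apply/ffunP=> i; case: (noI i).
pose P (K : seq I) (z : {ffun I -> Z}) i :=
  if i \in K then p i (z i) (w i) else (z i == w i)%:R.
have PE K : m w = \sum_z m z * \prod_i P K z i.
  elim: K => [|i K IH].
    rewrite (bigD1 w) //= big1 ?mulr1 => [|i _]; last by rewrite /P eqxx.
    rewrite big1 ?addr0 // => z zw.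
    have [i zwi] := ffun_neqP zw.
    by rewrite (bigD1 i) //= /P (negPf zwi) mul0r mulr0.
  have [iK|iK] := boolP (i \in K).
    rewrite IH; apply: eq_bigr => z _; congr (_ * _); apply: eq_bigr => k _.
    by rewrite /P inE; have [->|//] := eqVneq k i; rewrite iK.
  rewrite IH; apply: (mulfI (cardT_neq0 F Z_gt0)); rewrite -!(sum_line_sum i).
  apply: eq_bigr => z _; pose R := \prod_(k | k != i) P K z k.
  transitivity (m (upd z i (w i)) * R).
    rewrite /line_sum (bigD1 (w i)) //=.
    rewrite [X in _ + X]big1 ?addr0 => [|t /negPf tw].
      rewrite (bigD1 i) //= /P (negPf iK) upd_at eqxx mul1r; congr (_ * _).
      by apply: eq_bigr => k ki; rewrite upd_ne.
    by rewrite (bigD1 i) //= /P (negPf iK) upd_at tw mul0r mulr0.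
  rewrite -mp mulr_suml; apply: eq_bigr => t _.
  rewrite (bigD1 i) //= /P !inE eqxx upd_at -mulrA; congr (_ * (_ * _)).
  by apply: eq_bigr => k ki; rewrite !inE (negPf ki) upd_ne.
rewrite (PE (enum I)); apply: eq_bigr => z _; congr (_ * _).
by apply: eq_bigr => i _; rewrite /P mem_enum.
Qed.

(** * Base q digits and the matrix statement *)

Section Digits.
Variable q : nat.

(** The most significant digit comes first, as the Kronecker product in bigtens
    nests to the right. *)
Fixpoint digit n : 'I_(q ^ n) -> 'I_n -> 'I_q :=
  match n with
  | 0 => fun _ i => False_rect _ (Bool.diff_false_true (ltn_ord i))
  | n'.+1 => fun x i =>
      let p := mxtens_unindex (cast_ord (expnS q n') x) in
      if unlift ord0 i is Some j then digit p.2 j else p.1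
  end.

Definition digits n (x : 'I_(q ^ n)) : {ffun 'I_n -> 'I_q} := finfun (digit x).

Lemma bigtensE (F : fieldType) n (B : 'I_n -> 'M[F]_q) x y :
  bigtens B x y = \prod_i B i (digits x i) (digits y i).
Proof.
under eq_bigr do rewrite !ffunE.
elim: n B x y => [|n IHn] B x y.
  rewrite big_ord0 /= mxE; rewrite (_ : x = y) ?eqxx //.
  by move: x y; rewrite expn0 => x y; rewrite !ord1.
rewrite /= castmxE mxE big_ord_recl !unlift_none !esymK; congr (_ * _).
by rewrite IHn; apply: eq_bigr => i _; rewrite !liftK.
Qed.

Lemma digits_inj n : injective (@digits n).
Proof.
move=> x y /ffunP e; have {}e i : digit x i = digit y i.
  by have := e i; rewrite !ffunE.
elim: n x y e => [|n IHn] x y e.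
  by move: x y {e}; rewrite expn0 => x y; rewrite !ord1.
apply: (@cast_ord_inj _ _ (expnS q n)).
rewrite -[LHS]mxtens_unindexK -[RHS]mxtens_unindexK; congr mxtens_index.
have e0 := e ord0; rewrite /= unlift_none in e0.
apply/eqP; rewrite xpair_eqE e0 eqxx /=; apply/eqP/IHn => i.
by have := e (lift ord0 i); rewrite /= liftK.
Qed.

Lemma digits_bij n : bijective (@digits n).
Proof.
by apply: inj_card_bij; [exact: digits_inj | rewrite card_ffun !card_ord].
Qed.

End Digits.

Section HammingAction.
Variables (F : numFieldType) (I T : finType).
Local Notation X := {ffun I -> T}.

Lemma line_sum_mask (k : I) (x z : X) :
  \sum_t (z == upd x k t)%:R = \prod_(i | i != k) (x i == z i)%:R :> F.
Proof.
rewrite (bigD1 (z k)) //= big1 ?addr0 => [|t tz]; last first.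
  case: eqP => // e; move: tz; rewrite e upd_at eqxx //.
case: eqP => [->|ne].
  by rewrite big1 // => i ik; rewrite upd_ne // eqxx.
case: (ffun_neqP (introN eqP ne)) => i.
have [->|ik] := eqVneq i k; first by rewrite upd_at eqxx.
by rewrite upd_ne // => xz; rewrite (bigD1 i) //= eq_sym (negPf xz) mul0r.
Qed.

Definition hamming (x z : X) : F :=
  \sum_k \prod_i (if i == k then 1 - (x i == z i)%:R else (x i == z i)%:R).

Lemma hamming_line_sum f x :
  \sum_z hamming x z * f z = \sum_i line_sum i f x - #|I|%:R * f x.
Proof.
under eq_bigr do rewrite mulr_suml.
rewrite exchange_big mulr_natl -sumr_const -sumrB; apply: eq_bigr => k _.
transitivity (\sum_z (\sum_t (z == upd x k t)%:R - (x == z)%:R) * f z).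
  apply: eq_bigr => z _; congr (_ * _).
  rewrite line_sum_mask (bigD1 k) //= eqxx mulrBl mul1r.
  rewrite (eq_bigr (fun i => (x i == z i)%:R)) => [|i /negPf->] //.
  congr (_ - _); have [<-|xz] := eqVneq x z.
    by rewrite eqxx big1 ?mulr1 // => i _; rewrite eqxx.
  have [xzk|xzk] := eqVneq (x k) (z k); last by rewrite mul0r.
  have [i xzi] := ffun_neqP xz.
  rewrite (bigD1 i) /= ?(negPf xzi) ?mul0r ?mulr0 //.
  by apply: contraNneq xzi => ->; rewrite xzk.
under eq_bigr do rewrite mulrBl mulr_suml.
rewrite sumrB exchange_big /=; congr (_ - _).
  apply: eq_bigr => t _; rewrite (bigD1 (upd x k t)) //= eqxx mul1r.
  by rewrite big1 ?addr0 // => z /negPf->; rewrite mul0r.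
rewrite (bigD1 x) //= eqxx mul1r.
by rewrite big1 ?addr0 // => z; rewrite eq_sym => /negPf->; rewrite mul0r.
Qed.

End HammingAction.

Section Relabel.
Variables (F : numFieldType) (X : finType) (v : nat) (cod : X -> 'I_v).
Hypothesis cod_bij : bijective cod.
Implicit Types W M : 'M[F]_v.

Definition entries M : X -> X -> F := fun x y => M (cod x) (cod y).

Let card_X : #|X| = v.
Proof. by rewrite (bij_eq_card cod_bij) card_ord. Qed.

Lemma typeII_entries W : type2 W <-> typeII (entries W).
Proof.
have [dec decK codK] := cod_bij.
split=> [[W0 WW]|[W0 WW]]; split=> [x a|a b].
- exact: W0.
- have := WW (cod a) (cod b); rewrite (reindex cod) /=; last exact: onW_bij.
  by rewrite (can_eq decK) card_X.
- by have := W0 (dec x) (dec a); rewrite /entries !codK.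
have := WW (dec a) (dec b); rewrite /entries (can_eq codK) card_X => <-.
by rewrite (reindex cod) /= ?codK //; exact: onW_bij.
Qed.

Lemma nomura_entries W M (x0 : X) : type2 W ->
  nomura W M <-> nomuraf (entries W) (entries M).
Proof.
move=> W2; have [dec decK codK] := cod_bij.
have mulE a b x : (M *m quot_col W (cod a) (cod b)) (cod x) 0 =
    \sum_z entries M x z * quot (entries W) a b z.
  rewrite mxE (reindex cod) /=; last exact: onW_bij.
  by apply: eq_bigr => z _; rewrite mxE.
split=> [nM a b|nM a b].
  have [_ [lam /matrixP e]] := nM (cod a) (cod b).
  by exists lam => x; rewrite -mulE e !mxE.
split.
  apply/eqP=> /matrixP/(_ (cod x0) 0) /eqP.
  by rewrite !mxE mulf_eq0 invr_eq0 !(negPf (W2.1 _ _)).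
have [lam e] := nM (dec a) (dec b).
exists lam; apply/matrixP=> x j; rewrite ord1 -[x]codK -[a]codK -[b]codK.
by rewrite mulE e !mxE.
Qed.

End Relabel.

Section Projection.
Variables (F : fieldType) (v : nat).
Implicit Types (W M : 'M[F]_v).

(** M y is proportional to y iff the rank one matrix (M y) y^T is symmetric.
    This condition is linear in M, so the Nomura algebra is an intersection of
    kernels, hence a subspace onto which one can project. *)
Definition eigen_defect (y : 'cV[F]_v) M : 'M[F]_v :=
  M *m (y *m y^T) - (M *m (y *m y^T))^T.

Lemma eigen_defect_linear y : linear (eigen_defect y).
Proof.
move=> a M N; rewrite /eigen_defect mulmxDl -scalemxAl linearD linearZ /=.
by rewrite scalerBr opprD addrACA.
Qed.

HB.instance Definition _ y :=
  GRing.isLinear.Build F 'M[F]_v 'M[F]_v *:%R (eigen_defect y)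
    (eigen_defect_linear y).

Lemma eigen_defect_eq0 (y : 'cV[F]_v) M i : y i 0 != 0 ->
  eigen_defect y M = 0 <-> exists lam, M *m y = lam *: y.
Proof.
move=> yi; rewrite /eigen_defect mulmxA.
move: (M *m y) => z; split=> [|[lam ->]].
  move/eqP; rewrite subr_eq0 => /eqP/matrixP e.
  exists (z i 0 / y i 0); apply/matrixP=> j k; rewrite ord1.
  have := e j i; rewrite !mxE !big_ord1 !mxE => ej.
  by rewrite mulrAC -ej mulfK.
by apply/eqP; rewrite subr_eq0 -scalemxAl linearZ /= trmx_mul trmxK.
Qed.

Lemma nomura_projection W : (0 < v)%N -> type2 W ->
  exists P : {linear 'M[F]_v -> 'M[F]_v},
    (forall M, nomura W (P M)) /\ (forall M, nomura W M -> P M = M).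
Proof.
move=> v_gt0 W2; pose i0 := Ordinal v_gt0.
pose U := (\bigcap_(p : 'I_v * 'I_v)
  lker (linfun (eigen_defect (quot_col W p.1 p.2))))%VS.
have y_neq0 a b i : quot_col W a b i 0 != 0.
  by rewrite mxE mulf_neq0 ?invr_eq0 // W2.1.
have UP M : nomura W M <-> M \in U.
  rewrite memvE; split=> [nM|/subv_bigcapP MU a b].
    apply/subv_bigcapP => p _; rewrite -memvE memv_ker lfunE /=.
    by apply/eqP/(eigen_defect_eq0 _ (y_neq0 _ _ i0)); case: (nM p.1 p.2).
  split; first by apply: contraNneq (y_neq0 a b i0) => ->; rewrite mxE.
  apply/(eigen_defect_eq0 _ (y_neq0 _ _ i0)).
  have := MU (a, b) isT; rewrite -memvE memv_ker lfunE /= => /eqP; exact.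
exists (projv U); split=> M; first by apply/UP; exact: memv_proj.
by move/UP; exact: projv_id.
Qed.

End Projection.

Lemma nomuraf_rescale (F : numFieldType) (X : finType) (w w' M : X -> X -> F)
    (r kap : X -> F) (s : X -> X) :
    (forall x, r x != 0) -> (forall c, kap c != 0) -> bijective s ->
    (forall x c, w x c = r x * kap c * w' x (s c)) ->
  nomuraf w M <-> nomuraf w' M.
Proof.
move=> r0 kap0 [s' sK s'K] wE.
have qE a b x : quot w a b x = kap a / kap b * quot w' (s a) (s b) x.
  by rewrite /quot !wE -!mulf_div divff ?r0 // mul1r.
split=> nM a b.
  rewrite -(s'K a) -(s'K b); move: (s' a) (s' b) => {}a {}b.
  have [lam lamE] := nM a b; exists lam => x.
  have k0 : kap a / kap b != 0 by rewrite mulf_neq0 ?invr_eq0.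
  apply: (mulfI k0); rewrite [RHS]mulrCA -qE -lamE mulr_sumr.
  by apply: eq_bigr => z _; rewrite qE mulrCA.
have [lam lamE] := nM (s a) (s b); exists lam => x.
rewrite qE mulrCA -lamE mulr_sumr; apply: eq_bigr => z _.
by rewrite qE mulrCA.
Qed.

Lemma type2_equiv_perm (F : fieldType) (v : nat) (W B : 'M[F]_v)
    (r kap : 'I_v -> F) (s : 'I_v -> 'I_v) :
    (forall x, r x != 0) -> (forall c, kap c != 0) -> injective s ->
    (forall x c, W x c = r x * kap c * B x (s c)) ->
  type2_equiv W B.
Proof.
move=> r0 kap0 s_inj WE; pose pi := perm s_inj.
have unit_diag m (d : 'rV[F]_m) :
    (forall i, d 0 i != 0) -> diag_mx d \in unitmx.
  by move=> d0; rewrite unitmxE det_diag unitfE; apply/prodf_neq0 => i _.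
exists 1%:M, (diag_mx (\row_x r x)), (diag_mx (\row_c kap ((pi^-1)%g c))),
  (perm_mx (pi^-1)%g).
split.
- by split; [rewrite -perm_mx1|]; exact: perm_mx_is_perm.
- by split; [exact: diag_mx_is_diag | apply: unit_diag => i; rewrite mxE].
- by split; [exact: diag_mx_is_diag | apply: unit_diag => i; rewrite mxE].
rewrite mul1mx -col_permE; apply/matrixP=> x c; rewrite mxE.
rewrite mul_mx_diag mxE mul_diag_mx mxE !mxE permK permE WE.
by rewrite mulrAC.
Qed.

Lemma nomura_hamming_tensor (F : numFieldType) (n q : nat) (W : 'M[F]_(q ^ n)) :
    (2 < q)%N -> type2 W -> nomura W (hamming_adj F q n) ->
  exists Ws : 'I_n -> 'M[F]_q,
    [/\ forall i, type2 (Ws i), type2_equiv W (bigtens Ws) &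
        nomura W = tens_span (fun i => nomura (Ws i))].
Proof.
move=> q2 W2 WA; pose X := {ffun 'I_n -> 'I_q}.
have [cod digK codK] := digits_bij q n.
have cod_bij : bijective cod by exists (@digits q n).
pose w := entries cod W.
have wII : typeII w by apply/typeII_entries.
have cardT : (2 < #|'I_q|)%N by rewrite card_ord.
have q0 : (0 < q)%N by apply: leq_trans q2.
have cardT0 : (0 < #|'I_q|)%N by rewrite card_ord.
pose x0 : X := [ffun=> Ordinal q0].
have nomE M : nomura W M <-> nomuraf w (entries cod M).
  exact: nomura_entries.
have wH a b : exists mu, hamming_eigen mu (quot w a b).
  have [lam lamE] := (nomE _).1 WA a b.
  exists (lam + #|'I_n|%:R) => x; rewrite mulrDl -lamE.
  rewrite (eq_bigr (fun z => hamming F x z * quot w a b z)) => [|z _].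
    by rewrite hamming_line_sum subrK.
  congr (_ * _); rewrite /entries /hamming_adj summxE; apply: eq_bigr => k _.
  rewrite bigtensE !codK; apply: eq_bigr => i _.
  by case: (i == k); rewrite !mxE.
have [u [s [kap [b [uII s_inj kap0 wE]]]]] := tensor_structure cardT wII wH.
pose Ws i := \matrix_(t, c) u i t c : 'M[F]_q.
have Ws2 i : type2 (Ws i).
  split=> [t c|c c']; first by rewrite mxE; exact: (uII i).1.
  under eq_bigr do rewrite !mxE.
  by rewrite (uII i).2 card_ord.
have id_bij : bijective (@id 'I_q) by exists id.
pose e i := entries id (Ws i).
have eII i : typeII (e i) by apply/(typeII_entries id_bij).
have eE i : nomura (Ws i) = (fun N => nomuraf (e i) (entries id N)).
  by apply/seteqP; split=> N /(nomura_entries id_bij N (Ordinal q0) (Ws2 i)).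
have wE' x c : w x c = w x b * kap c * tensor e x (s c).
  by rewrite wE; congr (_ * _); apply: eq_bigr => i _; rewrite /e /entries mxE.
have s_bij : bijective s := injF_bij s_inj.
have nomT M : nomura W M <-> nomuraf (tensor e) (entries cod M).
  rewrite nomE; apply: nomuraf_rescale wE' => // x; exact: w_neq0.
have tensE B x y : bigtens B (cod x) (cod y) =
    tensor (fun i => entries id (B i)) x y :> F.
  by rewrite bigtensE !codK.
exists Ws; split=> //.
  pose s' c := cod (s (digits c)).
  have s'_inj : injective s'.
    by move=> c c' /(can_inj codK)/s_inj/digits_inj.
  apply: (@type2_equiv_perm F _ W (bigtens Ws) (fun x => w (digits x) b)
    (fun c => kap (digits c)) s') => // [x|x c]; first exact: w_neq0.
  have := wE' (digits x) (digits c); rewrite {1}/w /entries !digK => ->.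
  by rewrite -[in RHS](digK x) /s' tensE !digK.
apply/seteqP; split=> M; last first.
  move=> [m [c [N [NT ->]]]]; apply/nomT => a a'.
  have [lam lamE] : exists lam : 'I_m -> F, forall k x,
      \sum_z entries cod (N k) x z * quot (tensor e) a a' z =
      lam k * quot (tensor e) a a' x.
    apply: (@fin_all_exists _ (fun=> F) (fun k l => forall x,
      \sum_z entries cod (N k) x z * quot (tensor e) a a' z =
      l * quot (tensor e) a a' x)) => k.
    have [T nT <-] := NT k.
    have nT' i : nomuraf (e i) (entries id (T i)) by have := nT i; rewrite eE.
    have [l lE] := nomuraf_tensor nT' a a'; exists l => x; rewrite -lE.
    by apply: eq_bigr => z _; rewrite -tensE.
  exists (\sum_k c k * lam k) => x; rewrite mulr_suml.
  under [RHS]eq_bigr do rewrite -mulrA -lamE mulr_sumr.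
  rewrite exchange_big; apply: eq_bigr => z _.
  rewrite /entries summxE mulr_suml; apply: eq_bigr => k _.
  by rewrite mxE mulrA.
move=> /nomT nM.
have [P PP] : exists P : 'I_n -> {linear 'M[F]_q -> 'M[F]_q}, forall i,
    (forall N, nomura (Ws i) (P i N)) /\
    (forall N, nomura (Ws i) N -> P i N = N).
  apply: (@fin_all_exists _ (fun=> {linear 'M[F]_q -> 'M[F]_q}) (fun i p =>
    (forall N, nomura (Ws i) (p N)) /\ (forall N, nomura (Ws i) N -> p N = N))).
  by move=> i; exact: nomura_projection.
(* A pair of words is a word of pairs, so that M becomes a function m on Z. *)
pose Z := {ffun 'I_n -> 'I_q * 'I_q}.
pose z1 (z : Z) : X := [ffun i => (z i).1].
pose z2 (z : Z) : X := [ffun i => (z i).2].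
pose m z := entries cod M (z1 z) (z2 z).
pose p i (r t : 'I_q * 'I_q) := P i (delta_mx r.1 r.2) t.1 t.2.
have mp z i t : \sum_r m (upd z i r) * p i r t = m (upd z i t).
  have z1u r : z1 (upd z i r) = upd (z1 z) i r.1.
    by apply/ffunP=> k; rewrite !ffunE; case: eqP.
  have z2u r : z2 (upd z i r) = upd (z2 z) i r.2.
    by apply/ffunP=> k; rewrite !ffunE; case: eqP.
  pose N := \matrix_(s, t) entries cod M (upd (z1 z) i s) (upd (z2 z) i t).
  have nN : nomura (Ws i) N.
    rewrite eE => a a'.
    have [l lE] := nomuraf_slice eII cardT0 i (z1 z) (z2 z) nM a a'.
    by exists l => x; rewrite -lE; apply: eq_bigr => y _; rewrite /entries mxE.
  rewrite /m z1u z2u; transitivity (N t.1 t.2); last by rewrite mxE.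
  rewrite -((PP i).2 _ nN) [in RHS](matrix_sum_delta N) linear_sum summxE.
  under [RHS]eq_bigr do rewrite linear_sum summxE.
  rewrite pair_big; apply: eq_bigr => r _.
  by rewrite linearZ !mxE z1u z2u.
have mE := tensor_expand mp.
exists #|Z|, (fun k => m (enum_val k)),
  (fun k => let z : Z := enum_val k in
    bigtens (fun i => P i (delta_mx (z i).1 (z i).2))).
split.
  by move=> k; eexists; [|reflexivity] => i; exact: (PP i).1.
apply/matrixP=> x y; rewrite summxE.
transitivity (m [ffun i => (digits x i, digits y i)]).
  rewrite /m /entries; congr (M _ _).
    by rewrite -[LHS]digK; congr cod; apply/ffunP=> i; rewrite !ffunE.
  by rewrite -[LHS]digK; congr cod; apply/ffunP=> i; rewrite !ffunE.
rewrite mE; set d := finfun _.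
rewrite (big_enum_val (fun z : Z => m z * \prod_i p i (z i) (d i))) /=.
apply: eq_bigr => k _; rewrite mxE bigtensE; congr (_ * _).
by apply: eq_bigr => i _; rewrite /p ffunE.
Qed.

Local Open Scope classical_set_scope.

Theorem theorem5p3 (R : realType) (n q : nat) (hn : (2 <= n)%N)
    (hq : (3 <= q)%N) (W : 'M[complex R]_(q ^ n)) (hW : type2 W)
    (hA : nomura W (hamming_adj (complex R) q n)) :
  exists Ws : 'I_n -> 'M[complex R]_q,
    [/\ forall i, type2 (Ws i),
        type2_equiv W (bigtens Ws) &
        nomura W = tens_span (fun i => nomura (Ws i))].
Proof. exact: nomura_hamming_tensor. Qed.
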